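(* For every set of formulas $\Gamma$ and every formula $\phi$: if $\Gamma\vDash_{\mathbf{SU}}\phi$ then $\Gamma\vdash_{\mathbf{SU}}\phi$.
   Context: Formulas are built from countably many propositional variables and $\bot$ with $\land,\lor,\to$; $\neg\alpha$ abbreviates $\alpha\to\bot$. $\vdash_{\mathbf{SU}}$ is the consequence relation of the Hilbert system for intuitionistic propositional logic (with modus ponens) extended by all substitution instances of $\boldsymbol{su} = ((\neg p\to q)\land(\neg q\to p) \rightarrow r \vee s) \to ( p \rightarrow r) \vee(q \rightarrow s)$ as axioms; $\Gamma\vdash_{\mathbf{SU}}\phi$ means $\phi$ is derivable from assumptions in $\Gamma$. For an $\mathbf{S4}$ frame $\langle W,R\rangle$ ($R$ reflexive and transitive) and $X\subseteq W$ put $\mathord{\uparrow}X=\{w:\exists x\in X,\ xRw\}$, $\Diamond X=\{w:\exists x\in X,\ wRx\}$, $\Box X=\{w:\forall v(wRv\Rightarrow v\in X)\}$. A point $z$ strongly unites $x_0,x_1$ if $zRx_0$, $zRx_1$, $z\in\Box(\mathord{\uparrow}\{x_0\}\cup\Diamond\mathord{\uparrow}\{x_1\})$ and $z\in\Box(\mathord{\uparrow}\{x_1\}\cup\Diamond\mathord{\uparrow}\{x_0\})$. The frame satisfies $(su_2)$ if for every $w$ and all $x_0,x_1$ with $wRx_0$, $wRx_1$ there is $z$ with $wRz$ strongly uniting $x_0,x_1$. $\Gamma\vDash_{\mathbf{SU}}\phi$ means: for every $\mathbf{S4}$ frame satisfying $(su_2)$, every upward-closed valuation and every point, if all formulas of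 $\Gamma$ are true at the point (intuitionistic Kripke semantics) then $\phi$ is true there. *)

(* Defs.v *)
From Stdlib Require Import Ensembles Relations.

Inductive formula : Set :=
| Var (n : nat)
| Bot
| And (a b : formula)
| Or (a b : formula)
| Imp (a b : formula).

Definition Neg (a : formula) : formula := Imp a Bot.

Fixpoint subst (sigma : nat -> formula) (a : formula) : formula :=
  match a with
  | Var n => sigma n
  | Bot => Bot
  | And b c => And (subst sigma b) (subst sigma c)
  | Or b c => Or (subst sigma b) (subst sigma c)
  | Imp b c => Imp (subst sigma b) (subst sigma c)
  end.

Definition su : formula :=
  let p := Var 0 in let q := Var 1 in let r := Var 2 in let s := Var 3 in
  Imp (Imp (And (Imp (Neg p) q) (Imp (Neg q) p)) (Or r s))
      (Or (Imp p r) (Imp q s)).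

Inductive ipc_axiom : formula -> Prop :=
| ax_k a b : ipc_axiom (Imp a (Imp b a))
| ax_s a b c :
    ipc_axiom (Imp (Imp a (Imp b c)) (Imp (Imp a b) (Imp a c)))
| ax_and_l a b : ipc_axiom (Imp (And a b) a)
| ax_and_r a b : ipc_axiom (Imp (And a b) b)
| ax_and_i a b : ipc_axiom (Imp a (Imp b (And a b)))
| ax_or_l a b : ipc_axiom (Imp a (Or a b))
| ax_or_r a b : ipc_axiom (Imp b (Or a b))
| ax_or_e a b c :
    ipc_axiom (Imp (Imp a c) (Imp (Imp b c) (Imp (Or a b) c)))
| ax_bot a : ipc_axiom (Imp Bot a).

Inductive SU_derives (Gamma : Ensemble formula) : formula -> Prop :=
| d_hyp a : In formula Gamma a -> SU_derives Gamma a
| d_ipc a : ipc_axiom a -> SU_derives Gamma a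
| d_su sigma : SU_derives Gamma (subst sigma su)
| d_mp a b :
    SU_derives Gamma (Imp a b) -> SU_derives Gamma a -> SU_derives Gamma b.

Record S4_frame : Type := {
  world : Type;
  acc : relation world;
  acc_refl : reflexive world acc;
  acc_trans : transitive world acc
}.

Definition up (F : S4_frame) (X : Ensemble (world F)) : Ensemble (world F) :=
  fun w => exists x, In (world F) X x /\ acc F x w.

Definition diamond (F : S4_frame) (X : Ensemble (world F))
  : Ensemble (world F) :=
  fun w => exists x, In (world F) X x /\ acc F w x.

Definition box (F : S4_frame) (X : Ensemble (world F)) : Ensemble (world F) :=
  fun w => forall v, acc F w v -> In (world F) X v.

Definition strongly_unites (F : S4_frame) (z x0 x1 : world F) : Prop :=
  let W := world F in
  acc F z x0 /\ acc F z x1 /\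
  In W (box F (Union W (up F (Singleton W x0))
                       (diamond F (up F (Singleton W x1))))) z /\
  In W (box F (Union W (up F (Singleton W x1))
                       (diamond F (up F (Singleton W x0))))) z.

Definition su2 (F : S4_frame) : Prop :=
  forall w x0 x1 : world F, acc F w x0 -> acc F w x1 ->
    exists z, acc F w z /\ strongly_unites F z x0 x1.

Definition upward_closed (F : S4_frame) (X : Ensemble (world F)) : Prop :=
  forall w v, In (world F) X w -> acc F w v -> In (world F) X v.

Fixpoint forces (F : S4_frame) (V : nat -> Ensemble (world F)) (w : world F)
  (a : formula) : Prop :=
  match a with
  | Var n => In (world F) (V n) w
  | Bot => False
  | And b c => forces F V w b /\ forces F V w c
  | Or b c => forces F V w b \/ forces F V w c
  | Imp b c => forall v, acc F w v -> forces F V v b -> forces F V v c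
  end.

Definition SU_entails (Gamma : Ensemble formula) (phi : formula) : Prop :=
  forall F : S4_frame, su2 F ->
  forall V : nat -> Ensemble (world F), (forall n, upward_closed F (V n)) ->
  forall w : world F,
    (forall a, In formula Gamma a -> forces F V w a) -> forces F V w phi.

(* Main.v *)
Require Import Defs.
From Stdlib Require Import Ensembles.
From Stdlib Require Import Classical Arith Cantor.

(** Canonical model of consistent prime SU-theories ordered by inclusion.  To
    unite theories [x0] and [x1] above [w], add to [w] all implications
    [~p -> q] and [~q -> p] with [p] in [x0] and [q] in [x1].  Conjunctions
    replace finitely many of these by a single pair, so axiom [su] says exactly
    that the resulting set derives no [r \/ s] with [r] outside [x0] and [s]
    outside [x1]; such disjunctions form an ideal, and any prime theory [z]
    avoiding it lies below [x0] and [x1].  If [v] above [z] is incompatible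
    with [x1], then [v] contains [~q] for some [q] in [x1], hence all of [x0]. *)

Notation theory := (Ensemble formula).
Notation extend G a := (Add formula G a).

(** * Derived rules of the Hilbert system *)

Lemma derives_mono (G H : theory) a :
  Included formula G H -> SU_derives G a -> SU_derives H a.
Proof.
  intros HGH Ha.
  induction Ha as [a Ha|a Ha|sigma|a b _ IHab _ IHa].
  - apply d_hyp, HGH, Ha.
  - apply d_ipc, Ha.
  - apply d_su.
  - exact (d_mp _ _ _ IHab IHa).
Qed.

Lemma derives_extend (G : theory) a b :
  SU_derives G b -> SU_derives (extend G a) b.
Proof. apply derives_mono. intros c Hc. now left. Qed.

Lemma derives_last (G : theory) a : SU_derives (extend G a) a.
Proof. apply d_hyp. right. constructor. Qed.

Lemma derives_const (G : theory) a b :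
  SU_derives G b -> SU_derives G (Imp a b).
Proof. intros Hb. exact (d_mp _ _ _ (d_ipc _ _ (ax_k b a)) Hb). Qed.

Lemma derives_id (G : theory) a : SU_derives G (Imp a a).
Proof.
  apply (d_mp _ (Imp a (Imp a a))).
  - apply (d_mp _ (Imp a (Imp (Imp a a) a))); apply d_ipc; constructor.
  - apply d_ipc. constructor.
Qed.

(** Instances of [su] are axioms and modus ponens is the only rule, so the usual argument from
    [ax_k] and [ax_s] goes through. *)
Lemma deduction (G : theory) a b :
  SU_derives (extend G a) b -> SU_derives G (Imp a b).
Proof.
  intros Hb.
  induction Hb as [b Hb|b Hb|sigma|b c _ IHbc _ IHb].
  - destruct Hb as [b Hb|b Hb].
    + apply derives_const, d_hyp, Hb.
    + destruct Hb. apply derives_id.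
  - apply derives_const, d_ipc, Hb.
  - apply derives_const, d_su.
  - exact (d_mp _ _ _ (d_mp _ _ _ (d_ipc _ _ (ax_s a b c)) IHbc) IHb).
Qed.

Lemma derives_and (G : theory) a b :
  SU_derives G a -> SU_derives G b -> SU_derives G (And a b).
Proof.
  intros Ha Hb.
  exact (d_mp _ _ _ (d_mp _ _ _ (d_ipc _ _ (ax_and_i a b)) Ha) Hb).
Qed.

Lemma derives_and_l (G : theory) a b :
  SU_derives G (And a b) -> SU_derives G a.
Proof. apply d_mp, d_ipc, ax_and_l. Qed.

Lemma derives_and_r (G : theory) a b :
  SU_derives G (And a b) -> SU_derives G b.
Proof. apply d_mp, d_ipc, ax_and_r. Qed.

Lemma derives_or_l (G : theory) a b : SU_derives G a -> SU_derives G (Or a b).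
Proof. apply d_mp, d_ipc, ax_or_l. Qed.

Lemma derives_or_r (G : theory) a b : SU_derives G b -> SU_derives G (Or a b).
Proof. apply d_mp, d_ipc, ax_or_r. Qed.

Lemma derives_case (G : theory) a b c :
  SU_derives G (Or a b) -> SU_derives (extend G a) c ->
  SU_derives (extend G b) c -> SU_derives G c.
Proof.
  intros Hab Ha%deduction Hb%deduction.
  refine (d_mp _ _ _ (d_mp _ _ _ (d_mp _ _ _ (d_ipc _ _ _) Ha) Hb) Hab).
  constructor.
Qed.

Lemma derives_absurd (G : theory) a : SU_derives G Bot -> SU_derives G a.
Proof. apply d_mp, d_ipc, ax_bot. Qed.

Lemma derives_cut (G : theory) a b :
  SU_derives G a -> SU_derives (extend G a) b -> SU_derives G b.
Proof. intros Ha Hb%deduction. exact (d_mp _ _ _ Hb Ha). Qed.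

(** * Prime theories and the Lindenbaum construction *)

Record prime_theory (T : theory) : Prop := {
  pt_closed a : SU_derives T a -> In formula T a;
  pt_prime a b : In formula T (Or a b) -> In formula T a \/ In formula T b;
  pt_consistent : ~ In formula T Bot
}.

Fixpoint code (a : formula) : nat :=
  match a with
  | Var n => to_nat (0, n)
  | Bot => to_nat (1, 0)
  | And b c => to_nat (2, to_nat (code b, code c))
  | Or b c => to_nat (3, to_nat (code b, code c))
  | Imp b c => to_nat (4, to_nat (code b, code c))
  end.

Lemma to_nat_pair_inj m n m' n' :
  to_nat (m, n) = to_nat (m', n') -> m = m' /\ n = n'.
Proof. intros E%to_nat_inj. now injection E. Qed.

Lemma code_inj a b : code a = code b -> a = b.
Proof.
  revert b.
  induction a; intros [n'| |b1 b2|b1 b2|b1 b2] E; cbn [code] in E;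
    apply to_nat_pair_inj in E; destruct E as [Etag E]; try discriminate Etag;
    try (apply to_nat_pair_inj in E; destruct E); f_equal; auto.
Qed.

Section Lindenbaum.

Variables G D : theory.

Definition avoids (T : theory) : Prop :=
  forall d, In formula D d -> ~ SU_derives T d.

(** The test for avoidance is part of the membership predicate, so nothing has to be decided or
    decoded; a number coding no formula leaves the theory unchanged. *)
Fixpoint stage (n : nat) : theory :=
  match n with
  | 0 => G
  | S n => fun a =>
      In formula (stage n) a \/ code a = n /\ avoids (extend (stage n) a)
  end.

Definition stage_limit : theory := fun a => exists n, In formula (stage n) a.

Lemma stage_mono m n : m <= n -> Included formula (stage m) (stage n).
Proof.
  induction 1 as [|n _ IH]; intros a Ha; [exact Ha|].
  left. apply IH, Ha.
Qed.

Lemma stage_avoids n : avoids G -> avoids (stage n).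
Proof.
  intros HG.
  induction n as [|n IH]; [exact HG|].
  destruct (classic (exists a, code a = n /\ avoids (extend (stage n) a)))
    as [(a & Ea & Ha)|Hno]; intros d Hd Hder.
  - apply (Ha d Hd). revert Hder. apply derives_mono.
    intros b [Hb|[Eb _]]; [now left|].
    (* By injectivity of [code], this stage adds no formula other than [a]. *)
    right. rewrite (code_inj b a) by congruence. constructor.
  - apply (IH d Hd). revert Hder. apply derives_mono.
    intros b [Hb|Hb]; [exact Hb|].
    contradict Hno. now exists b.
Qed.

Lemma stage_limit_compact a :
  SU_derives stage_limit a -> exists n, SU_derives (stage n) a.
Proof.
  intros Ha.
  induction Ha as [a [n Ha]|a Ha|sigma|a b _ [m IHab] _ [n IHa]].
  - exists n. now apply d_hyp.
  - exists 0. now apply d_ipc.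
  - exists 0. apply d_su.
  - exists (max m n). apply (d_mp _ a).
    + revert IHab. apply derives_mono, stage_mono, Nat.le_max_l.
    + revert IHa. apply derives_mono, stage_mono, Nat.le_max_r.
Qed.

Lemma stage_limit_avoids : avoids G -> avoids stage_limit.
Proof.
  intros HG d Hd Hder.
  destruct (stage_limit_compact d Hder) as [n Hn].
  exact (stage_avoids n HG d Hd Hn).
Qed.

(** A formula outside the limit was rejected at stage [S (code a)], and the derivation that caused
    this survives in the larger limit. *)
Lemma stage_limit_maximal a :
  ~ In formula stage_limit a ->
  exists d, In formula D d /\ SU_derives (extend stage_limit a) d.
Proof.
  intros Ha.
  apply NNPP. intros Hno.
  apply Ha. exists (S (code a)). right. split; [reflexivity|].
  intros d Hd Hder. apply Hno. exists d. split; [exact Hd|].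
  revert Hder. apply derives_mono.
  intros b [b' Hb|b' Hb]; [left; now exists (code a)|now right].
Qed.

(** Primeness rests on [D] being directed under provable implication: if both disjuncts were
    missing, each would derive a member of [D], and a common upper bound of the two would follow
    from the disjunction. *)
Lemma prime_extension :
  (exists d, In formula D d) ->
  (forall a b, In formula D a -> In formula D b ->
    exists c, In formula D c /\ SU_derives (Empty_set formula) (Imp a c) /\
      SU_derives (Empty_set formula) (Imp b c)) ->
  avoids G ->
  exists T, prime_theory T /\ Included formula G T /\
    forall d, In formula D d -> ~ In formula T d.
Proof.
  intros [d0 Hd0] Hjoin HG.
  pose proof (stage_limit_avoids HG) as Hlim.
  assert (Hclosed : forall a,
             SU_derives stage_limit a -> In formula stage_limit a).
  { intros a Ha. apply NNPP. intros Hna.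
    destruct (stage_limit_maximal a Hna) as (d & Hd & Hder).
    exact (Hlim d Hd (derives_cut _ _ _ Ha Hder)). }
  exists stage_limit.
  split; [split|split].
  - exact Hclosed.
  - intros a b Hab.
    apply NNPP. intros [Ha Hb]%not_or_and.
    destruct (stage_limit_maximal a Ha) as (d & Hd & Hder).
    destruct (stage_limit_maximal b Hb) as (e & He & Her).
    destruct (Hjoin d e Hd He) as (c & Hc & Hdc & Hec).
    apply (Hlim c Hc), (derives_case _ a b).
    + now apply d_hyp.
    + apply (d_mp _ d); [|exact Hder].
      revert Hdc. now apply derives_mono.
    + apply (d_mp _ e); [|exact Her].
      revert Hec. now apply derives_mono.
  (* Consistency comes from [D] being inhabited, as [Bot] would derive [d0]. *)
  - intros Hbot.
    apply (Hlim d0 Hd0), derives_absurd, d_hyp, Hbot.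
  - intros a Ha. now exists 0.
  - intros d Hd Hin. exact (Hlim d Hd (d_hyp _ _ Hin)).
Qed.

End Lindenbaum.

Lemma prime_extension_formula (G : theory) a :
  ~ SU_derives G a ->
  exists T, prime_theory T /\ Included formula G T /\ ~ In formula T a.
Proof.
  intros Ha.
  destruct (prime_extension G (Singleton formula a)) as (T & HT & HGT & Hav).
  - exists a. constructor.
  - intros b c [] []. exists a. repeat split; apply derives_id.
  - intros b []. exact Ha.
  - exists T. split; [exact HT|split; [exact HGT|]].
    apply Hav. constructor.
Qed.

(** * The canonical model and its truth lemma *)

Definition canonical : S4_frame.
Proof.
  refine {| world := {T : theory | prime_theory T};
            acc := fun S T => Included formula (proj1_sig S) (proj1_sig T) |}.
  - intros T a Ha. exact Ha.
  - intros S T U HST HTU a Ha. apply HTU, HST, Ha.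
Defined.

Definition canonical_val (n : nat) : Ensemble (world canonical) :=
  fun T => In formula (proj1_sig T) (Var n).

Lemma truth a (T : world canonical) :
  forces canonical canonical_val T a <-> In formula (proj1_sig T) a.
Proof.
  revert T.
  induction a as [n| |a IHa b IHb|a IHa b IHb|a IHa b IHb];
    intros [T HT]; cbn.
  - reflexivity.
  - split; [intros []|apply (pt_consistent _ HT)].
  - rewrite IHa, IHb. cbn. split.
    + intros [Ha Hb].
      apply (pt_closed _ HT), derives_and; now apply d_hyp.
    + intros Hab%d_hyp. split; apply (pt_closed _ HT).
      * exact (derives_and_l _ _ _ Hab).
      * exact (derives_and_r _ _ _ Hab).
  - rewrite IHa, IHb. cbn. split.
    + intros [Ha|Hb]; apply (pt_closed _ HT).
      * now apply derives_or_l, d_hyp.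
      * now apply derives_or_r, d_hyp.
    + apply (pt_prime _ HT).
  - split.
    (* If [b] did not follow from [T] and [a], some prime theory above both would omit [b], against
       [Himp]. *)
    + intros Himp. apply (pt_closed _ HT), deduction, NNPP. intros Hb.
      destruct (prime_extension_formula _ _ Hb) as (U & HU & HTU & HUb).
      apply HUb, (IHb (exist _ U HU)), Himp.
      * intros c Hc. apply HTU. now left.
      * apply IHa, HTU. right. constructor.
    + intros Hab [U HU] HTU Ha%IHa. apply IHb. cbn in *.
      apply (pt_closed _ HU), (d_mp _ a); now apply d_hyp; auto.
Qed.

(** * A prime theory below two given ones *)

Definition union_premise (p q : formula) : formula :=
  And (Imp (Neg p) q) (Imp (Neg q) p).

Definition union_base (w x0 x1 : theory) : theory := fun a =>
  In formula w a \/
  exists p q, In formula x0 p /\ In formula x1 q /\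
    (a = Imp (Neg p) q \/ a = Imp (Neg q) p).

Lemma neg_and_l (G : theory) a b :
  SU_derives G (Neg a) -> SU_derives G (Neg (And a b)).
Proof.
  intros Ha. apply deduction, (d_mp _ a).
  - apply derives_extend, Ha.
  - apply (derives_and_l _ _ b), derives_last.
Qed.

Lemma neg_and_r (G : theory) a b :
  SU_derives G (Neg b) -> SU_derives G (Neg (And a b)).
Proof.
  intros Hb. apply deduction, (d_mp _ b).
  - apply derives_extend, Hb.
  - apply (derives_and_r _ a), derives_last.
Qed.

(** The negation of a conjunct refutes the conjunction, which yields the other conjunction and hence
    its conjunct. This lets two pairs be merged into one. *)
Lemma union_premise_l (G : theory) p p' q q' :
  SU_derives G (union_premise (And p p') (And q q')) ->
  SU_derives G (union_premise p q).
Proof.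
  intros H. apply derives_and; apply deduction.
  - apply (derives_and_l _ _ q'), (d_mp _ (Neg (And p p'))).
    + apply derives_extend, (derives_and_l _ _ _ H).
    + apply neg_and_l, derives_last.
  - apply (derives_and_l _ _ p'), (d_mp _ (Neg (And q q'))).
    + apply derives_extend, (derives_and_r _ _ _ H).
    + apply neg_and_l, derives_last.
Qed.

Lemma union_premise_r (G : theory) p p' q q' :
  SU_derives G (union_premise (And p p') (And q q')) ->
  SU_derives G (union_premise p' q').
Proof.
  intros H. apply derives_and; apply deduction.
  - apply (derives_and_r _ q), (d_mp _ (Neg (And p p'))).
    + apply derives_extend, (derives_and_l _ _ _ H).
    + apply neg_and_r, derives_last.
  - apply (derives_and_r _ p), (d_mp _ (Neg (And q q'))).
    + apply derives_extend, (derives_and_r _ _ _ H).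
    + apply neg_and_r, derives_last.
Qed.

Lemma union_base_compact (w x0 x1 : theory) a :
  prime_theory x0 -> prime_theory x1 ->
  SU_derives (union_base w x0 x1) a ->
  exists p q, In formula x0 p /\ In formula x1 q /\
    SU_derives w (Imp (union_premise p q) a).
Proof.
  intros H0 H1 Ha.
  assert (Hpure : forall b, SU_derives w b ->
    exists p q, In formula x0 p /\ In formula x1 q /\
      SU_derives w (Imp (union_premise p q) b)).
  (* Any pair works here; a provable formula lies in every prime theory. *)
  { intros b Hb. exists (Imp Bot Bot), (Imp Bot Bot).
    split; [apply (pt_closed _ H0), derives_id|].
    split; [apply (pt_closed _ H1), derives_id|].
    apply derives_const, Hb. }
  induction Ha as [a Ha|a Ha|sigma|a b _ IHab _ IHa].
  - destruct Ha as [Ha|(p & q & Hp & Hq & Ha)].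
    + apply Hpure, d_hyp, Ha.
    + exists p, q. split; [exact Hp|]. split; [exact Hq|].
      apply d_ipc. destruct Ha as [-> | ->]; constructor.
  - apply Hpure, d_ipc, Ha.
  - apply Hpure, d_su.
  - destruct IHab as (p & q & Hp & Hq & Hab).
    destruct IHa as (p' & q' & Hp' & Hq' & Ha).
    exists (And p p'), (And q q').
    split; [apply (pt_closed _ H0), derives_and; now apply d_hyp|].
    split; [apply (pt_closed _ H1), derives_and; now apply d_hyp|].
    apply deduction, (d_mp _ a).
    + apply (d_mp _ (union_premise p q)); [now apply derives_extend|].
      apply (union_premise_l _ p p' q q'), derives_last.
    + apply (d_mp _ (union_premise p' q')); [now apply derives_extend|].
      apply (union_premise_r _ p p' q q'), derives_last.
Qed.

Lemma derives_su_instance (G : theory) p q r s :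
  SU_derives G (Imp (Imp (union_premise p q) (Or r s))
                    (Or (Imp p r) (Imp q s))).
Proof.
  exact (d_su G (fun n => match n with 0 => p | 1 => q | 2 => r | _ => s end)).
Qed.

(** After compactness, [su] and primeness of [w] put [p -> r] or [q -> s] into [w]; modus ponens in
    [x0] or [x1] then contradicts the choice of [r] or [s]. *)
Lemma union_base_avoids (w x0 x1 : theory) r s :
  prime_theory w -> prime_theory x0 -> prime_theory x1 ->
  Included formula w x0 -> Included formula w x1 ->
  ~ In formula x0 r -> ~ In formula x1 s ->
  ~ SU_derives (union_base w x0 x1) (Or r s).
Proof.
  intros Hw H0 H1 H0w H1w Hr Hs Hder.
  destruct (union_base_compact _ _ _ _ H0 H1 Hder) as (p & q & Hp & Hq & Hrs).
  pose proof (d_mp _ _ _ (derives_su_instance w p q r s) Hrs) as Hor.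
  apply (pt_closed _ Hw), (pt_prime _ Hw) in Hor.
  destruct Hor as [Hpr|Hqs].
  - apply Hr, (pt_closed _ H0), (d_mp _ p); apply d_hyp; auto.
  - apply Hs, (pt_closed _ H1), (d_mp _ q); apply d_hyp; auto.
Qed.

Lemma uniting_theory (w x0 x1 : theory) :
  prime_theory w -> prime_theory x0 -> prime_theory x1 ->
  Included formula w x0 -> Included formula w x1 ->
  exists z, prime_theory z /\ Included formula (union_base w x0 x1) z /\
    Included formula z x0 /\ Included formula z x1.
Proof.
  intros Hw H0 H1 H0w H1w.
  destruct (prime_extension (union_base w x0 x1)
    (fun d => exists r s, d = Or r s /\ ~ In formula x0 r /\ ~ In formula x1 s))
    as (z & Hz & Hbase & Hav).
  - exists (Or Bot Bot), Bot, Bot.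
    split; [reflexivity|].
    split; [apply (pt_consistent _ H0)|apply (pt_consistent _ H1)].
  - intros a b (r & s & -> & Hr & Hs) (r' & s' & -> & Hr' & Hs').
    exists (Or (Or r r') (Or s s')).
    split; [|split].
    + exists (Or r r'), (Or s s'). split; [reflexivity|].
      split; [intros [|]%(pt_prime _ H0)|intros [|]%(pt_prime _ H1)]; auto.
    + apply deduction, (derives_case _ r s);
        [apply derives_last|apply derives_or_l|apply derives_or_r];
        apply derives_or_l, derives_last.
    + apply deduction, (derives_case _ r' s');
        [apply derives_last|apply derives_or_l|apply derives_or_r];
        apply derives_or_r, derives_last.
  - intros d (r & s & -> & Hr & Hs). now apply union_base_avoids.
  - exists z. split; [exact Hz|]. split; [exact Hbase|].
    split; intros a Ha; apply NNPP; intros Hna.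
    (* Padding with [Bot], absent from both theories, turns avoidance of disjunctions into each of
       the two inclusions. *)
    + apply (Hav (Or a Bot)).
      * exists a, Bot. auto using pt_consistent.
      * apply (pt_closed _ Hz), derives_or_l, d_hyp, Ha.
    + apply (Hav (Or Bot a)).
      * exists Bot, a. auto using pt_consistent.
      * apply (pt_closed _ Hz), derives_or_r, d_hyp, Ha.
Qed.

(** * Strong uniting in the canonical frame *)

(** A derivation uses finitely many members of [T], and their conjunction is again in [T]. *)
Lemma derives_union_compact (S T : theory) a :
  prime_theory T -> SU_derives (Union formula S T) a ->
  exists q, In formula T q /\ SU_derives S (Imp q a).
Proof.
  intros HT Ha.
  assert (Htop : In formula T (Imp Bot Bot))
    by apply (pt_closed _ HT), derives_id.
  induction Ha as [a [b Ha|b Ha]|a Ha|sigma|a b _ IHab _ IHa].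
  - exists (Imp Bot Bot). split; [exact Htop|].
    apply derives_const, d_hyp, Ha.
  - exists b. split; [exact Ha|apply derives_id].
  - exists (Imp Bot Bot). split; [exact Htop|].
    apply derives_const, d_ipc, Ha.
  - exists (Imp Bot Bot). split; [exact Htop|].
    apply derives_const, d_su.
  - destruct IHab as (p & Hp & Hab), IHa as (q & Hq & Ha).
    exists (And p q).
    split; [apply (pt_closed _ HT), derives_and; now apply d_hyp|].
    apply deduction, (d_mp _ a).
    + apply (d_mp _ p); [now apply derives_extend|].
      apply (derives_and_l _ _ q), derives_last.
    + apply (d_mp _ q); [now apply derives_extend|].
      apply (derives_and_r _ p), derives_last.
Qed.

(** If [v] and [y] are jointly consistent, a prime theory above both witnesses the diamond.
    Otherwise [v] derives [~q] for some [q] in [y], and the hypothesis gives all of [x]. *)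
Lemma compatible_or_above (v x y : world canonical) :
  (forall p q, In formula (proj1_sig x) p -> In formula (proj1_sig y) q ->
    In formula (proj1_sig v) (Imp (Neg q) p)) ->
  In (world canonical)
     (Union (world canonical)
        (up canonical (Singleton (world canonical) x))
        (diamond canonical (up canonical (Singleton (world canonical) y)))) v.
Proof.
  destruct v as [v Hv], x as [x Hx], y as [y Hy]. cbn. intros Himp.
  destruct (classic (SU_derives (Union formula v y) Bot)) as [Hbot|Hcons].
  - left. exists (exist _ x Hx). split; [constructor|].
    destruct (derives_union_compact _ _ _ Hy Hbot) as (q & Hq & Hnq).
    intros p Hp. cbn.
    apply (pt_closed _ Hv), (d_mp _ (Neg q)); [|exact Hnq].
    apply d_hyp, Himp; assumption.
  - right.
    destruct (prime_extension_formula _ _ Hcons) as (u & Hu & Hvyu & _).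
    exists (exist _ u Hu). split.
    + exists (exist _ y Hy). split; [constructor|].
      intros a Ha. apply Hvyu. now right.
    + intros a Ha. apply Hvyu. now left.
Qed.

Lemma canonical_su2 : su2 canonical.
Proof.
  intros [w Hw] [x0 H0] [x1 H1] H0w H1w.
  destruct (uniting_theory w x0 x1 Hw H0 H1 H0w H1w)
    as (z & Hz & Hbase & Hz0 & Hz1).
  exists (exist _ z Hz). split.
  - intros a Ha. apply Hbase. now left.
  - split; [exact Hz0|]. split; [exact Hz1|].
    (* The implications [~q -> p] serve the first half; with the two theories exchanged, [~p -> q]
       serve the second. *)
    split; intros v Hzv; apply compatible_or_above; cbn;
      intros p q Hp Hq; apply Hzv, Hbase; right.
    + exists p, q. auto.
    + exists q, p. auto.
Qed.

(** * Strong completeness by contraposition *)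

Theorem theorem3 (Gamma : Ensemble formula) (phi : formula) :
  SU_entails Gamma phi -> SU_derives Gamma phi.
Proof.
  intros Hent.
  apply NNPP. intros Hphi.
  (* This theory is the canonical world that forces [Gamma] and refutes [phi]. *)
  destruct (prime_extension_formula _ _ Hphi) as (T & HT & HGT & HTphi).
  apply HTphi, (truth phi (exist _ T HT)), Hent.
  - apply canonical_su2.
  - intros n S U HS HSU. apply HSU, HS.
  - intros a Ha. apply truth, HGT, Ha.
Qed.
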